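(* The game CRIM restricted to hooks is returnable but not forced, and miserable but not pet.
   Context: A partition is a finite weakly decreasing sequence of positive integers; the empty partition $[\,]$ is allowed. A hook is a partition of the form $[c,1^{r-1}]$ with $r,c\ge1$ (one part $c$ followed by $r-1$ parts equal to $1$); this includes the rows $[c]$ and the columns $[1^r]$. A move of CRIM removes one row (deletes one part) or one column from the Young diagram of a partition, with the remaining pieces re-attached to form a partition; removing a column means deleting a part from the conjugate partition and conjugating back. CRIM on hooks is the game whose positions are all hooks together with $[\,]$ and whose moves are the CRIM moves (this set is closed under moves). The only terminal position is $[\,]$. The Sprague-Grundy value $\mathcal{G}(\lambda)$ is the minimal excluded nonnegative integer (mex) of the values $\mathcal{G}(\mu)$ over all $\mu$ reachable from $\lambda$ in one move, so terminal positions have value $0$. The misère Grundy value $\mathcal{G}^-(\lambda)$ satisfies the same mex recursion at non-terminal positions, but terminal positions have $\mathcal{G}^-=1$. A position is called an $(a,b)$-position if its Conway pair $(\mathcal{G}(\lambda),\mathcal{G}^-(\lambda))$ equals $(a,b)$. A game is: - returnable if for any move from a $(0,1)$-position (resp. a $(1,0)$-position) to a non-terminal position $y$, there is a move from $y$ to a $(0,1)$-position (resp. to a $(1,0)$-position); - forced if each move from a $(0,1)$-position results in a $(1,0)$-position and vice versa; - miserable if for every position $x$ one of the following holds: (i) $x$ is a $(0,1)$-position or a $(1,0)$-position; (ii) there is no move from $x$ to a $(0,1)$-position or $(1,0)$-position; (iii) there are moves from $x$ to both a $(0,1)$-position and a $(1,0)$-position; - pet if it has only $(0,1)$-positions, $(1,0)$-positions,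 and $(k,k)$-positions with $k\ge2$. *)

(* Defs.v *)
From HB Require Import structures.
From mathcomp Require Import all_boot.

Set Implicit Arguments.
Unset Strict Implicit.
Unset Printing Implicit Defensive.

(** * Impartial games *)

(** The rank only witnesses that the game has no infinite play; all the notions
    below depend on the options alone (see [sgE] and [misereE]). *)
Record game := Game {
  position :> eqType;
  options : position -> seq position;
  rank : position -> nat;
  rank_options : forall x y, y \in options x -> rank y < rank x
}.

Definition terminal (G : game) (x : G) : bool := options x == [::].

Definition mex (s : seq nat) : nat :=
  find (fun n => n \notin s) (iota 0 (size s).+1).

Lemma mexP s : mex s \notin s /\ forall m, m < mex s -> m \in s.
Proof.
have hs : has (fun n => n \notin s) (iota 0 (size s).+1).
  apply/negPn/negP; rewrite -all_predC => /allP sub.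
  have /uniq_leq_size : {subset iota 0 (size s).+1 <= s}.
    by move=> x /sub /= /negPn.
  by move/(_ (iota_uniq _ _)); rewrite size_iota ltnn.
have lt_mex : mex s < (size s).+1 by move: hs; rewrite has_find size_iota.
split; first by have := nth_find 0 hs; rewrite nth_iota.
move=> m lt_m; have := before_find 0 lt_m.
by rewrite nth_iota ?add0n ?(ltn_trans lt_m) // => /negbFE.
Qed.

(** Grundy function with value [t] at terminal positions; [n] is fuel. *)
Fixpoint grundy_rec (G : game) (t n : nat) (x : G) : nat :=
  if n is n'.+1 then
    if terminal x then t else mex [seq grundy_rec t n' y | y <- options x]
  else t.

Definition grundy (G : game) (t : nat) (x : G) : nat :=
  grundy_rec t (rank x).+1 x.

Lemma grundyE (G : game) t (x : G) :
  grundy t x = if terminal x then t else mex [seq grundy t y | y <- options x].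
Proof.
have fuel n m (y : G) :
    rank y < n -> rank y < m -> grundy_rec t n y = grundy_rec t m y.
  elim: n m y => // n IHn [//|m] y lt_n lt_m /=; case: ifP => // _.
  congr mex; apply/eq_in_map => z /rank_options lt_z.
  by apply: IHn; apply: leq_trans lt_z _.
rewrite {1}/grundy /=; case: ifP => // _; congr mex.
by apply/eq_in_map => y /rank_options lt_y; apply: fuel.
Qed.

(** Sprague-Grundy value *)
Definition sg (G : game) (x : G) : nat := grundy 0 x.

(** misère Grundy value *)
Definition misere (G : game) (x : G) : nat := grundy 1 x.

Lemma sgE (G : game) (x : G) : sg x = mex [seq sg y | y <- options x].
Proof. by rewrite /sg grundyE /terminal; case: eqVneq => // ->. Qed.

Lemma misereE (G : game) (x : G) :
  misere x = if terminal x then 1 else mex [seq misere y | y <- options x].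
Proof. exact: grundyE. Qed.

Definition conway_pair (G : game) (x : G) : nat * nat := (sg x, misere x).

Definition returnable (G : game) : Prop :=
  forall ab : nat * nat, ab = (0, 1) \/ ab = (1, 0) ->
  forall x y : G, conway_pair x = ab -> y \in options x -> ~~ terminal y ->
  exists2 z, z \in options y & conway_pair z = ab.

Definition forced (G : game) : Prop :=
  forall x y : G, y \in options x ->
    (conway_pair x = (0, 1) -> conway_pair y = (1, 0)) /\
    (conway_pair x = (1, 0) -> conway_pair y = (0, 1)).

Definition miserable (G : game) : Prop :=
  forall x : G,
    [\/ conway_pair x = (0, 1) \/ conway_pair x = (1, 0),
        ~ (exists2 y, y \in options x &
             conway_pair y = (0, 1) \/ conway_pair y = (1, 0))
      | (exists2 y, y \in options x & conway_pair y = (0, 1)) /\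
        (exists2 y, y \in options x & conway_pair y = (1, 0))].

Definition pet (G : game) : Prop :=
  forall x : G,
    [\/ conway_pair x = (0, 1), conway_pair x = (1, 0)
      | exists2 k, 2 <= k & conway_pair x = (k, k)].

(** The game restricted to the positions satisfying [P]. Options outside [P]
    are dropped; when [P] is closed under moves, there are none. *)
Section Restrict.
Variables (G : game) (P : pred G).

Definition restrict_options (x : {x : G | P x}) : seq {x : G | P x} :=
  pmap insub (options (val x)).

Lemma restrict_rank (x y : {x : G | P x}) :
  y \in restrict_options x -> rank (val y) < rank (val x).
Proof. by rewrite mem_pmap_sub => /rank_options. Qed.

Definition restrict : game := Game restrict_rank.
End Restrict.

(** * Partitions *)

Definition is_partition (s : seq nat) : bool := sorted geq s && (0 \notin s).

Record partition := Partition {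
  parts :> seq nat;
  partsP : is_partition parts
}.

HB.instance Definition _ := [isSub for parts].
HB.instance Definition _ := [Equality of partition by <:].

Lemma is_partition_rem x s : is_partition s -> is_partition (rem x s).
Proof.
case/andP=> srt pos; apply/andP; split.
  apply: (subseq_sorted _ (rem_subseq x s) srt).
  by move=> b a c ab bc; apply: leq_trans bc ab.
by apply: contra pos => /mem_rem.
Qed.

Definition delete_part (x : nat) (p : partition) : partition :=
  Partition (is_partition_rem x (partsP p)).

(** The [j]-th part of the conjugate counts the parts larger than [j]. *)
Definition conj_seq (s : seq nat) : seq nat :=
  mkseq (fun j => count (ltn j) s) (head 0 s).

Lemma is_partition_conj s : is_partition s -> is_partition (conj_seq s).
Proof.
move=> _; apply/andP; split.
  rewrite /conj_seq /mkseq; apply: (@homo_sorted _ _ _ leq); last first.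
    exact: iota_sorted.
  by move=> i j le_ij; apply: sub_count => x; apply: leq_ltn_trans.
apply/mapP => -[j]; rewrite mem_iota /= add0n.
by case: s => //= x s lt_jx /esym/eqP; rewrite lt_jx.
Qed.

Definition conj_part (p : partition) : partition :=
  Partition (is_partition_conj (partsP p)).

Lemma sumn_conj (p : partition) : sumn (conj_part p) = sumn p.
Proof.
case: p => s /= /andP[srt _].
have le_head : all (geq (head 0 s)) s.
  case: s srt => //= x s; rewrite leqnn /= path_sortedE; last first.
    by move=> b a c ab bc; apply: leq_trans bc ab.
  by case/andP.
rewrite /conj_seq; move: (head 0 s) le_head => n {srt}.
elim: s => [_|x s IHs /= /andP[le_xn le_sn]].
  by rewrite /mkseq /= sumnE big_map big1_seq.
rewrite -IHs // /mkseq !sumnE !big_map big_split /=; congr (_ + _).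
have ->: iota 0 n = index_iota 0 n by rewrite /index_iota subn0.
rewrite (@big_cat_nat _ _ _ x) //= [X in _ + X]big_nat_cond [X in _ + X]big1 ?addn0.
  rewrite (eq_big_nat _ _ (F2 := fun=> 1)) ?sum_nat_const_nat ?subn0 ?muln1 //.
  by move=> i /andP[_ ->].
by move=> i; rewrite andbT => /andP[le_xi _]; rewrite ltnNge le_xi.
Qed.

(** * CRIM *)

Definition row_moves (p : partition) : seq partition :=
  [seq delete_part x p | x <- parts p].

Definition column_moves (p : partition) : seq partition :=
  [seq conj_part q | q <- row_moves (conj_part p)].

Definition crim_options (p : partition) : seq partition :=
  row_moves p ++ column_moves p.

Lemma sumn_row_moves (p q : partition) : q \in row_moves p -> sumn q < sumn p.
Proof.
case/mapP=> x xp ->; rewrite (perm_sumn (perm_to_rem xp)) /= -add1n leq_add2r.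
case: p xp => s sP /= xs; rewrite lt0n; apply: contraL xs => /eqP->.
by case/andP: sP.
Qed.

Lemma sumn_crim_options (p q : partition) :
  q \in crim_options p -> sumn q < sumn p.
Proof.
rewrite mem_cat => /orP[/sumn_row_moves //|/mapP[r /sumn_row_moves lt_r ->]].
by rewrite sumn_conj -(sumn_conj p).
Qed.

Definition crim : game := Game sumn_crim_options.

Definition is_hook (s : seq nat) : bool :=
  if s is c :: t then (1 <= c) && all (pred1 1) t else false.

Lemma is_hookP s :
  reflect (exists r c, [/\ 1 <= r, 1 <= c & s = c :: nseq (r - 1) 1]) (is_hook s).
Proof.
apply: (iffP idP) => [|[r [c [_ c_gt0 ->]]]]; last first.
  by rewrite /= c_gt0; apply/all_pred1P; rewrite size_nseq.
case: s => //= c t /andP[c_gt0 /all_pred1P def_t].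
by exists (size t).+1, c; rewrite subn1 /= -def_t.
Qed.

Definition hook_or_empty (p : partition) : bool :=
  (parts p == [::]) || is_hook (parts p).

Definition crim_hooks : game := @restrict crim hook_or_empty.

Lemma hook_or_empty_delete x p :
  hook_or_empty p -> hook_or_empty (delete_part x p).
Proof.
case: p => [[|c t] //= sP]; rewrite /hook_or_empty /= => /andP[c_gt0 t1].
case: ifP => _ /=; first by case: t t1 {sP} => //= a t /andP[/eqP-> ->].
apply/andP; split=> //; apply/allP => y /mem_rem; exact/allP.
Qed.

Lemma hook_or_empty_conj p : hook_or_empty p -> hook_or_empty (conj_part p).
Proof.
case: p => [[|c t] //= sP]; rewrite /hook_or_empty /= => /andP[c_gt0 t1].
rewrite /conj_seq /=; case: c c_gt0 {sP} => //= c _.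
apply/allP => y /mapP[j]; rewrite mem_iota => /andP[j_gt0 lt_jc] -> /=.
rewrite lt_jc -[X in _ == X]addn0 eqn_add2l -leqn0 leqNgt -has_count.
apply/hasPn => z /(allP t1) /eqP ->.
by rewrite /= -leqNgt.
Qed.

Lemma hook_or_empty_options (p q : partition) :
  hook_or_empty p -> q \in crim_options p -> hook_or_empty q.
Proof.
move=> hp; rewrite mem_cat => /orP[/mapP[x _ ->]|].
  exact: hook_or_empty_delete.
case/mapP=> r /mapP[x _ ->] ->.
by apply/hook_or_empty_conj/hook_or_empty_delete/hook_or_empty_conj.
Qed.

Lemma crim_hooks_options (x : crim_hooks) :
  map val (options x) = crim_options (val x).
Proof.
rewrite /= /restrict_options pmap_filter; last exact: insubK.
apply/all_filterP/allP => q /(hook_or_empty_options (valP x)) hq.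
by rewrite isSome_insub.
Qed.

(* Main.v *)
Require Import Defs.
From mathcomp Require Import all_boot.

(** Index the hook [[a+1, 1^b]] by its arm [a] and leg [b]. A row or a column
    with [n] cells has Conway pair (0,1) if [n = 0], (1,0) if [n] is odd and
    (2,2) otherwise; a hook with [a, b > 0] has pair (0,1) if [a] and [b] are odd,
    (0,0) if both are even, and (3,3) otherwise. Hence a non-terminal position has
    a move to a (0,1)-position iff its pair is (1,0), (2,2) or (3,3), and to a
    (1,0)-position iff its pair is (0,1), (2,2) or (3,3). As neither Grundy value
    is preserved by a move, this gives returnability, and miserability follows at
    once. The move from [[2,1]] to [[2]] is not forced, and [[3,1,1]] is a
    (0,0)-position. *)

Lemma mex_unique s m : m \notin s -> (forall k, k < m -> k \in s) -> mex s = m.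
Proof.
move=> m_notin lt_in; have [mex_notin lt_mex_in] := mexP s.
case: (ltngtP (mex s) m) => // [/lt_in | /lt_mex_in].
  by rewrite (negPf mex_notin).
by rewrite (negPf m_notin).
Qed.

Lemma eq_mex s t : s =i t -> mex s = mex t.
Proof.
by move=> eq_st; have [notin lt_in] := mexP t; apply: mex_unique => [|k /lt_in];
  rewrite eq_st.
Qed.

Lemma sg_option (G : game) (x y : G) : y \in options x -> sg y != sg x.
Proof.
move=> xy; have [notin _] := mexP [seq sg z | z <- options x].
by apply: contra notin => /eqP eq_yx; rewrite -sgE -eq_yx map_f.
Qed.

Lemma misere_option (G : game) (x y : G) :
  y \in options x -> misere y != misere x.
Proof.
move=> xy; have [notin _] := mexP [seq misere z | z <- options x].
apply: contra notin => /eqP eq_yx.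
have nt: terminal x = false by rewrite /terminal; case: (options x) xy.
by move: (misereE x); rewrite nt => <-; rewrite -eq_yx map_f.
Qed.

Definition hook (a b : nat) : seq nat := a.+1 :: nseq b 1.

Lemma conj_hook a b : conj_seq (hook a b) = hook b a.
Proof.
rewrite /conj_seq /mkseq /= count_nseq mul1n; congr (_ :: _).
apply: (@eq_from_nth _ 0); rewrite ?size_map ?size_iota ?size_nseq // => i lt_ia.
rewrite (nth_map 0) ?size_iota // nth_iota // nth_nseq lt_ia count_nseq /=.
by rewrite add1n ltnS lt_ia.
Qed.

(** The boolean coercion makes [nseq (0 < n) n] the row with [n] cells, and the empty partition when
    [n = 0]. *)
Lemma conj_column n : conj_seq (nseq n 1) = nseq (0 < n) n.
Proof.
by case: n => // n; rewrite -[nseq _ _]/(hook 0 n) conj_hook.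
Qed.

Lemma rem_hook a b :
  [seq rem x (hook a b) | x <- hook a b] =
    nseq b 1 :: nseq b (hook a b.-1).
Proof.
rewrite /= eqxx map_nseq; congr (_ :: _).
case: b => // b; congr nseq; rewrite /hook /=.
(* When [a = 0] the head is itself a 1, so [rem] deletes it instead of a leg cell; the column left
   is the same. *)
by case: a.
Qed.

(** Row moves, then column moves, with multiplicity. At 0 the predecessors [b.-1] and [a.-1] do no
    harm, as the [nseq] around them is then empty. *)
Definition hook_moves a b : seq (seq nat) :=
  (nseq b 1 :: nseq b (hook a b.-1)) ++
  (nseq (0 < a) a :: nseq a (hook a.-1 b)).

Definition shape (x : crim_hooks) : seq nat := parts (val x).

Lemma shape_options (x : crim_hooks) a b :
  shape x = hook a b -> [seq shape y | y <- options x] = hook_moves a b.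
Proof.
move=> def_x; rewrite [LHS](map_comp parts val) crim_hooks_options.
rewrite /crim_options map_cat; congr (_ ++ _).
  by rewrite /row_moves -map_comp -rem_hook -def_x.
(* Conjugation swaps arm and leg, so [rem_hook] also computes the column moves. *)
have def_c : parts (conj_part (val x)) = hook b a by rewrite -conj_hook -def_x.
transitivity (map conj_seq [seq rem y (hook b a) | y <- hook b a]).
  rewrite /column_moves /row_moves -def_c.
  by rewrite -[LHS]map_comp -[LHS]map_comp -[RHS]map_comp.
rewrite rem_hook /= conj_column map_nseq; congr (_ :: _).
by case: a {def_x def_c} => // a; rewrite conj_hook.
Qed.

Lemma shapeP (x : crim_hooks) :
  (terminal x /\ shape x = [::]) \/
  (~~ terminal x /\ exists a b, shape x = hook a b).
Proof.
case/orP: (valP x) => [/eqP x0|/is_hookP[r [[|a] [_ // _ def_x]]]]; last first.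
  right; split; last by exists a, (r - 1).
  have := shape_options x a (r - 1) def_x.
  by rewrite /terminal; case: (options x).
left; split=> //; rewrite /terminal -size_eq0 -(size_map val) crim_hooks_options.
by rewrite size_cat !size_map x0.
Qed.

Definition line_pair n : nat * nat :=
  if n == 0 then (0, 1) else if odd n then (1, 0) else (2, 2).

Definition hook_pair a b : nat * nat :=
  if a == 0 then line_pair b.+1 else if b == 0 then line_pair a.+1
  else if odd a then if odd b then (0, 1) else (3, 3)
  else if odd b then (3, 3) else (0, 0).

Definition move_pairs a b : seq (nat * nat) :=
  (line_pair b :: nseq b (hook_pair a b.-1)) ++
  (line_pair a :: nseq a (hook_pair a.-1 b)).

(** A mex ignores multiplicity: keeping one copy of each repeated pair leaves at most four entries,
    so mex and membership can be computed by cases. *)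
Lemma mem_map_move_pairs (T : eqType) (f : nat * nat -> T) a b :
  map f (move_pairs a b) =i
    map f (line_pair b :: nseq (0 < b) (hook_pair a b.-1)) ++
    map f (line_pair a :: nseq (0 < a) (hook_pair a.-1 b)).
Proof.
move=> v; rewrite map_cat /= !map_nseq !(mem_cat, inE, mem_nseq).
by case: a b => [|a] [|b].
Qed.

Lemma mex_move_pairs a b :
  (mex (unzip1 (move_pairs a b)), mex (unzip2 (move_pairs a b))) =
  hook_pair a b.
Proof.
rewrite (eq_mex _ _ (mem_map_move_pairs _ fst a b)).
rewrite (eq_mex _ _ (mem_map_move_pairs _ snd a b)).
(* The values 0 and 1 are split off because a move from 1 can reach a degenerate hook; from 2 on
   only parity matters. *)
by case: a b => [|[|a]] [|[|b]]; rewrite /hook_pair /line_pair //=;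
  try case: (odd a); try case: (odd b).
Qed.

Definition shape_pair (s : seq nat) : nat * nat :=
  if s is c :: t then hook_pair c.-1 (size t) else (0, 1).

Lemma shape_pair_column n : shape_pair (nseq n 1) = line_pair n.
Proof. by case: n => // n; rewrite /= size_nseq. Qed.

Lemma shape_pair_row n : shape_pair (nseq (0 < n) n) = line_pair n.
Proof. by case: n => // n; rewrite /= /hook_pair; case: n. Qed.

Lemma shape_pair_hook a b : shape_pair (hook a b) = hook_pair a b.
Proof. by rewrite /= size_nseq. Qed.

Lemma shape_pair_moves a b : map shape_pair (hook_moves a b) = move_pairs a b.
Proof.
rewrite map_cat !map_cons !map_nseq shape_pair_column shape_pair_row.
by rewrite !shape_pair_hook.
Qed.

Lemma conway_pairE (x : crim_hooks) : conway_pair x = shape_pair (shape x).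
Proof.
have [n] := ubnP (rank x); elim: n x => // n IHn x /ltnSE le_xn.
have [[tx ->]|[ntx [a [b def_x]]]] := shapeP x.
  by rewrite /conway_pair sgE misereE tx (eqP tx).
have opt_pairs : [seq conway_pair y | y <- options x] = move_pairs a b.
  rewrite -shape_pair_moves -(shape_options x) // -map_comp.
  apply/eq_in_map => y /rank_options lt_yx.
  by apply: IHn; apply: leq_trans lt_yx le_xn.
rewrite def_x shape_pair_hook -mex_move_pairs -opt_pairs /unzip1 /unzip2.
by rewrite -!map_comp /conway_pair sgE misereE (negPf ntx).
Qed.

Lemma conway_pair_options (x : crim_hooks) a b :
  shape x = hook a b -> [seq conway_pair y | y <- options x] = move_pairs a b.
Proof.
move=> def_x; rewrite (eq_map conway_pairE) map_comp (shape_options x a b) //.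
exact: shape_pair_moves.
Qed.

Lemma mem_move_pairs a b :
  (((0, 1) \in move_pairs a b) =
     (hook_pair a b \in [:: (1, 0); (2, 2); (3, 3)])) *
  (((1, 0) \in move_pairs a b) =
     (hook_pair a b \in [:: (0, 1); (2, 2); (3, 3)])).
Proof.
(* The identity map brings the list into the form that [mem_map_move_pairs] collapses. *)
rewrite -[move_pairs a b]map_id; split; rewrite mem_map_move_pairs.
all: by case: a b => [|[|a]] [|[|b]]; rewrite /hook_pair /line_pair //=;
  try case: (odd a); try case: (odd b).
Qed.

Lemma hook_pair_cases a b :
  hook_pair a b \in [:: (0, 1); (1, 0); (2, 2); (3, 3); (0, 0)].
Proof.
by rewrite /hook_pair /line_pair; case: a b => [|a] [|b] //=;
  try case: (odd a); try case: (odd b).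
Qed.

Lemma mem_conway_options (G : game) (x : G) ab :
  (exists2 y, y \in options x & conway_pair y = ab) <->
  ab \in [seq conway_pair y | y <- options x].
Proof. by split=> [[y xy <-]|/mapP[y xy ->]]; [apply: map_f | exists y]. Qed.

Lemma hook_position a b : exists x : crim_hooks, shape x = hook a b.
Proof.
have part : is_partition (hook a b).
  rewrite /is_partition /= inE mem_nseq andbF andbT.
  by elim: b a => //= b IHb a; rewrite (IHb 0).
have hookP : hook_or_empty (Partition part).
  by rewrite /hook_or_empty /= all_nseq orbT.
by exists (Sub (Partition part) hookP).
Qed.

(** The empty position must be excluded: its pair is (0,1), yet it has no move to a
    (1,0)-position. *)
Lemma crim_hooks_nonterminal (x : crim_hooks) : ~~ terminal x ->
  [/\ conway_pair x \in [:: (0, 1); (1, 0); (2, 2); (3, 3); (0, 0)],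
      (exists2 y, y \in options x & conway_pair y = (0, 1)) <->
        conway_pair x \in [:: (1, 0); (2, 2); (3, 3)]
    & (exists2 y, y \in options x & conway_pair y = (1, 0)) <->
        conway_pair x \in [:: (0, 1); (2, 2); (3, 3)]].
Proof.
have [[-> //]|[_ [a [b def_x]]] _] := shapeP x.
have opt_pairs := conway_pair_options x a b def_x.
rewrite conway_pairE def_x shape_pair_hook -(mem_move_pairs a b).1.
rewrite -(mem_move_pairs a b).2 -opt_pairs.
by split; [apply: hook_pair_cases | apply: mem_conway_options..].
Qed.

Theorem theorem20 :
  [/\ returnable crim_hooks, ~ forced crim_hooks,
      miserable crim_hooks & ~ pet crim_hooks].
Proof.
split.
- move=> ab ab01 x y cp_x xy /crim_hooks_nonterminal[cp_y to01 to10].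
  (* The pair of [y] differs from that of [x] in both coordinates. This excludes [ab] itself, and
     also (0,0), which shares a 0 with both (0,1) and (1,0). *)
  have := sg_option _ _ _ xy; have := misere_option _ _ _ xy.
  case: ab01 cp_x => -> [-> ->] mis_y sg_y; [apply/to01 | apply/to10].
    move: cp_y mis_y sg_y; rewrite /conway_pair !inE !xpair_eqE.
    by case: (sg y) (misere y) => [|[|[|[|g]]]] [|[|[|[|m]]]].
  move: cp_y mis_y sg_y; rewrite /conway_pair !inE !xpair_eqE.
  by case: (sg y) (misere y) => [|[|[|[|g]]]] [|[|[|[|m]]]].
- have [x def_x] := hook_position 1 1; move=> forced_hooks.
  have [|y xy cp_y] := (mem_conway_options _ x (2, 2)).2.
    by rewrite (conway_pair_options x 1 1).
  have [] := forced_hooks x y xy; rewrite cp_y conway_pairE def_x.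
  by move=> /(_ erefl).
- move=> x; have [tx|ntx] := boolP (terminal x).
    by apply: Or31; left; rewrite /conway_pair sgE misereE tx (eqP tx).
  have [cp_x to01 to10] := crim_hooks_nonterminal x ntx.
  move: cp_x to01 to10; rewrite !inE.
  case/or4P=> [/eqP->|/eqP->|/eqP->|/orP[]/eqP->] to01 to10.
  + by apply: Or31; left.
  + by apply: Or31; right.
  + by apply: Or33; split; [apply/to01 | apply/to10].
  + by apply: Or33; split; [apply/to01 | apply/to10].
  (* The pair left is (0,0), which lies in neither list, so a move to a (0,1)- or (1,0)-position is
     contradictory. *)
  apply: Or32 => -[y xy [] cp_y].
    by have /to01 : exists2 y, y \in options x & conway_pair y = (0, 1) by exists y.
  by have /to10 : exists2 y, y \in options x & conway_pair y = (1, 0) by exists y.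
- have [x def_x] := hook_position 2 2; move=> /(_ x).
  by rewrite conway_pairE def_x; case=> // -[k k_ge2 [k0]]; rewrite -k0 in k_ge2.
Qed.
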